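(* (a) Let $G_1$ and $G_2$ be $A$-cospectral regular graphs and let $H$ be any regular graph. Then $H\odot G_1$ and $H\odot G_2$ are $A$-cospectral. (b) Let $G_1$ and $G_2$ be $A$-cospectral regular graphs and let $H$ be any regular graph. Then $G_1\odot H$ and $G_2\odot H$ are $A$-cospectral. (c) Let $G_1$ and $G_2$ be $A$-cospectral regular graphs, and let $H_1$ and $H_2$ be another pair of $A$-cospectral regular graphs. Then $G_1\odot H_1$ and $G_2\odot H_2$ are $A$-cospectral.
   Context: All graphs are finite, simple and connected. Two non-isomorphic graphs are called $A$-cospectral if their adjacency matrices have the same eigenvalues with the same multiplicities. The central graph $C(G)$ of $G$ is obtained from $G$ by subdividing each edge of $G$ exactly once and joining all pairs of distinct vertices of $G$ that are nonadjacent in $G$. For graphs $G,G'$, the central vertex corona $G\odot G'$ is obtained by taking one copy of $C(G)$ and $|V(G)|$ copies of $G'$, and joining the $i$-th vertex $v_i$ of $G$ (viewed in $C(G)$) to every vertex in the $i$-th copy of $G'$, for each $i$. *)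

(* Defs.v *)
From mathcomp Require Import all_boot all_order all_algebra.
Set Implicit Arguments.
Unset Strict Implicit.
Unset Printing Implicit Defensive.
Import GRing.Theory.
Local Open Scope ring_scope.

Record sgraph := SGraph {
  vertex :> finType;
  adj : rel vertex;
  adj_sym : symmetric adj;
  adj_irrefl : irreflexive adj }.

(* The empty graph is not connected. *)
Definition connected (G : sgraph) : Prop :=
  (0 < #|G|)%N /\ forall x y : G, connect (@adj G) x y.

Definition regular (G : sgraph) : Prop :=
  exists k : nat, forall x : G, #|[set y | adj x y]| = k.

Definition isomorphic (G G' : sgraph) : Prop :=
  exists2 f : G -> G', bijective f & forall x y, adj (f x) (f y) = adj x y.

Section Spectrum.
Variable C : numClosedFieldType.

Definition adjmx (G : sgraph) : 'M[C]_#|G| :=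
  \matrix_(i, j) (adj (enum_val i) (enum_val j))%:R.

Definition same_spectrum m n (A : 'M[C]_m) (B : 'M[C]_n) : Prop :=
  forall a : C, eigenvalue A a = eigenvalue B a /\
    (eigenvalue A a -> mup a (char_poly A) = mup a (char_poly B)).

Definition A_cospectral (G G' : sgraph) : Prop :=
  ~ isomorphic G G' /\ same_spectrum (adjmx G) (adjmx G').

End Spectrum.

Definition edges (G : sgraph) : {set {set G}} :=
  [set [set p.1; p.2] | p : G * G & adj p.1 p.2].

Section CentralGraph.
Variable G : sgraph.

(* [inr e] is the vertex subdividing the edge e. *)
Definition central_vertex : finType := (G + {e : {set G} | e \in edges G})%type.

Definition central_adj (a b : central_vertex) : bool :=
  match a, b with
  | inl u, inl v => (u != v) && ~~ adj u v
  | inl u, inr e => u \in val e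
  | inr e, inl v => v \in val e
  | inr _, inr _ => false
  end.

Lemma central_adj_sym : symmetric central_adj.
Proof. by case=> [u|e] [v|f] //=; rewrite eq_sym adj_sym. Qed.

Lemma central_adj_irrefl : irreflexive central_adj.
Proof. by case=> [u|e] //=; rewrite eqxx. Qed.

Definition central : sgraph := SGraph central_adj_sym central_adj_irrefl.

End CentralGraph.

Section CentralVertexCorona.
Variables G G' : sgraph.

(* [inr (v, x)] is the vertex x of the copy of G' attached to v. *)
Definition corona_vertex : finType := (central G + G * G')%type.

Definition corona_adj (a b : corona_vertex) : bool :=
  match a, b with
  | inl s, inl t => adj s t
  | inl (inl u), inr (v, _) => u == v
  | inr (v, _), inl (inl u) => u == v
  | inr (u, x), inr (v, y) => (u == v) && adj x y
  | _, _ => false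
  end.

Lemma corona_adj_sym : symmetric corona_adj.
Proof.
case=> [[u|e]|[u x]] [[v|f]|[v y]] //=; first by rewrite eq_sym adj_sym.
by rewrite eq_sym adj_sym.
Qed.

Lemma corona_adj_irrefl : irreflexive corona_adj.
Proof.
by case=> [[u|e]|[u x]] //=; rewrite ?eqxx ?adj_irrefl.
Qed.

Definition corona : sgraph := SGraph corona_adj_sym corona_adj_irrefl.

Lemma corona_connected : connected G -> connected corona.
Proof.
case=> /card_gt0P[u0 _] conG.
have symC : connect_sym (@adj corona) by apply: sym_connect_sym; apply: adj_sym.
have step u v : adj u v ->
    connect (@adj corona) (inl (inl u)) (inl (inl v)).
  move=> uv; have eP : [set u; v] \in edges G.
    by apply/imsetP; exists (u, v); rewrite ?inE.
  pose e : corona := inl (inr (exist (fun A => A \in edges G) _ eP)).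
  by apply: (@connect_trans _ _ e); apply: connect1; rewrite /= !inE eqxx ?orbT.
have base v : connect (@adj corona) (inl (inl u0)) (inl (inl v)).
  have /connectP[p] := conG u0 v.
  elim: p u0 => [|w p IHp] u /=; first by move=> _ ->.
  by case/andP=> /step uw pw /(IHp _ pw); apply: connect_trans.
have all_base (a : corona) : connect (@adj corona) (inl (inl u0)) a.
  case: a => [[v|[e eP]]|[v x]]; first exact: base.
  - case/imsetP: (eP) => -[u v] _ /= eE.
    apply: (connect_trans (base u)); apply: connect1.
    by rewrite /= eE !inE eqxx.
  - by apply: (connect_trans (base v)); apply: connect1; rewrite /= eqxx.
split; first by apply/card_gt0P; exists (inl (inl u0)).
by move=> a b; apply: connect_trans (all_base b); rewrite symC.
Qed.

End CentralVertexCorona.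

(* Main.v *)
Require Import Defs.
From mathcomp Require Import all_boot all_order all_algebra.
From mathcomp Require Import perm ring zify.
Set Implicit Arguments.
Unset Strict Implicit.
Unset Printing Implicit Defensive.
Import Order.TTheory GRing.Theory Num.Theory.
Local Open Scope ring_scope.

(** The spectral half rests on a closed formula.  Let G be r-regular and H be
    s-regular, with adjacency matrices A and B, n = #|G|, m = #|H|, and let J be
    the all-ones matrix.  Order the vertices of the corona of G and H as the
    vertices of G, then the edges of G, then the copies of H.  For a scalar
    a other than 0 and s, taking the Schur complement of the copies, then that
    of the edges, in a * I minus the adjacency matrix of the corona gives
      det (c I + d A - J) * a ^ e * (char_poly B).[a] ^ n,
      c = a + 1 - r / a - m / (a - s),  d = 1 - 1 / a,
    where e is the number of edges of G.  It uses that the all-ones vector is an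
    eigenvector of B for s, and that R R^T = A + r I for the incidence matrix R
    of G ([char_poly_corona]).  Since A J = r J, the first factor only depends
    on r, c, d and the characteristic polynomial of A ([char_poly_subJ]).  As n, r
    and e are determined by that polynomial, and m and s by that of B, the
    value of the characteristic polynomial of the corona at all but two scalars is
    determined by the spectra of G and H, which is enough ([corona_char_poly_eq]).

    For the non-isomorphism half, two regular non-isomorphic connected graphs
    of the same order and degree are neither edgeless nor complete.  When this
    applies to the base graphs or to the attached graphs, it makes the degree
    n - 1 + m of the vertices of G in the corona larger than the other degrees, 2
    and s + 1, so that an isomorphism of coronas preserves the set of these
    vertices ([iso_is_base]).  It therefore induces an isomorphism
    of the complements of the base graphs ([iso_corona_base]).  If moreover H
    has no isolated vertex, the copy of H attached to a vertex v consists of the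
    neighbours of v outside of the base that have a neighbour outside of the
    base, hence it is mapped to a copy ([iso_corona_copy]). *)

(** * Determinants indexed by finite types *)

Section KernelDeterminant.
Variable R : comNzRingType.

(** The square matrix of a kernel [M] on a finite type, and its determinant;
    [adjmx] is the instance where [M] is the adjacency relation. *)
Definition kermat (T : finType) (M : T -> T -> R) : 'M[R]_#|T| :=
  \matrix_(i, j) M (enum_val i) (enum_val j).

Definition detf (T : finType) (M : T -> T -> R) : R := \det (kermat M).

Lemma sum_enum_val (T : finType) (F : T -> R) :
  \sum_(t : T) F t = \sum_(i < #|T|) F (enum_val i).
Proof. by rewrite -[RHS]big_enum_val. Qed.

Lemma eq_detf (T : finType) (M N : T -> T -> R) :
  M =2 N -> detf M = detf N.
Proof. by move=> MN; congr (\det _); apply/matrixP=> i j; rewrite !mxE. Qed.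

(** The determinant does not depend on the enumeration of the index type. *)
Lemma detf_reindex (T : finType) (M : T -> T -> R) n (e : 'I_n -> T) :
  injective e -> n = #|T| -> \det (\matrix_(i, j) M (e i) (e j)) = detf M.
Proof.
move=> inj_e n_eq; rewrite {n}n_eq in e inj_e *.
have inj_s : injective (fun i => enum_rank (e i)).
  by apply: inj_comp => //; apply: enum_rank_inj.
pose s := perm inj_s.
have -> : \matrix_(i, j) M (e i) (e j) = row_perm s (col_perm s (kermat M)).
  by apply/matrixP=> i j; rewrite !mxE !permE /= !enum_rankK.
rewrite row_permE col_permE !det_mulmx !det_perm odd_permV mulrCA.
by rewrite -signr_addb addbb mulr1.
Qed.

Lemma detf_bij (S T : finType) (h : S -> T) (M : T -> T -> R) :
  injective h -> #|S| = #|T| -> detf (fun x y => M (h x) (h y)) = detf M.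
Proof.
move=> inj_h card_eq.
rewrite -(@detf_reindex _ M _ (fun i : 'I_#|S| => h (enum_val i))) //.
by apply: inj_comp => //; apply: enum_val_inj.
Qed.

(** The Schur complement formula for the lower right block.  That block need not
    be invertible: a solution [X] of the linear system that would define its
    inverse times the lower left block suffices. *)
Lemma detf_schur (S T : finType) (M : S + T -> S + T -> R) (X : T -> S -> R) :
    (forall t s, M (inr t) (inl s) = \sum_t' M (inr t) (inr t') * X t' s) ->
  detf M =
    detf (fun s s' => M (inl s) (inl s') - \sum_t M (inl s) (inr t) * X t s')
    * detf (fun t t' => M (inr t) (inr t')).
Proof.
move=> MX.
pose e (i : 'I_(#|S| + #|T|)) : (S + T)%type :=
  match split i with inl a => inl (enum_val a) | inr b => inr (enum_val b) end.
have inj_e : injective e.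
  move=> i j; rewrite /e => eij; apply: (can_inj (@splitK _ _)).
  by move: eij; case: (split i) => a; case: (split j) => b // [/enum_val_inj->].
rewrite -(detf_reindex M inj_e) ?card_sum //.
pose P := kermat (fun s s' => M (inl s) (inl s')).
pose W := kermat (fun t t' => M (inr t) (inr t')).
pose U : 'M[R]_(#|S|, #|T|) :=
  \matrix_(i, j) M (inl (enum_val i)) (inr (enum_val j)).
pose Y : 'M[R]_(#|T|, #|S|) := \matrix_(i, j) X (enum_val i) (enum_val j).
have -> : \matrix_(i, j) M (e i) (e j) = block_mx P U (W *m Y) W.
  apply/matrixP=> i j; rewrite [LHS]mxE /e.
  case: (split_ordP i) => a ->; case: (split_ordP j) => b ->.
  - by rewrite block_mxEul mxE.
  - by rewrite block_mxEur mxE.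
  - rewrite block_mxEdl mxE MX sum_enum_val /=.
    by apply: eq_bigr => k _; rewrite !mxE.
  - by rewrite block_mxEdr mxE.
have <- : \det (block_mx P U (W *m Y) W *m block_mx 1%:M 0 (- Y) 1%:M)
          = \det (block_mx P U (W *m Y) W).
  by rewrite det_mulmx det_lblock !det1 !mulr1.
rewrite mulmx_block !mulmx1 !mulmx0 !add0r !mulmxN subrr det_ublock.
congr (\det _ * _); apply/matrixP=> i j; rewrite !mxE [in RHS]sum_enum_val.
by congr (_ - _); apply: eq_bigr => k _; rewrite !mxE.
Qed.

Lemma detf_diag (T : finType) (a : R) :
  detf (fun x y : T => a *+ (x == y)) = a ^+ #|T|.
Proof.
rewrite -det_scalar; congr (\det _); apply/matrixP=> i j.
by rewrite !mxE (inj_eq enum_val_inj).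
Qed.

Lemma detf_card0 (T : finType) (M : T -> T -> R) : #|T| = 0%N -> detf M = 1.
Proof.
by move=> T0; rewrite /detf; move: (kermat M); rewrite T0 => A; apply: det_mx00.
Qed.

(** The Kronecker product of an identity matrix with [K]. *)
Lemma detf_ord_copies (T : finType) (K : T -> T -> R) n :
  detf (fun a b : 'I_n * T => K a.2 b.2 *+ (a.1 == b.1)) = detf K ^+ n.
Proof.
elim: n => [|n IHn]; first by rewrite detf_card0 // card_prod card_ord mul0n.
pose h (x : T + 'I_n * T) : 'I_n.+1 * T :=
  match x with inl t => (ord0, t) | inr (i, t) => (lift ord0 i, t) end.
rewrite -(@detf_bij _ _ h); first last.
- by rewrite card_sum !card_prod !card_ord mulSn.
- case=> [t|[i t]] [u|[j u]] /= /pair_equal_spec [] //.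
  + by move=> _ ->.
  + by move=> /lift_inj-> ->.
rewrite (detf_schur (X := fun _ _ => 0)) /=; last first.
  by case=> i t u; rewrite big1 // => *; rewrite mulr0.
rewrite exprS -IHn; congr (_ * _); apply: eq_detf => x y /=.
  by rewrite big1 ?subr0 ?mulr1n // => *; rewrite mulr0.
by case: x y => [i t] [j u] /=; rewrite (inj_eq lift_inj).
Qed.

Lemma detf_copies (S T : finType) (K : T -> T -> R) :
  detf (fun a b : S * T => K a.2 b.2 *+ (a.1 == b.1)) = detf K ^+ #|S|.
Proof.
rewrite -detf_ord_copies.
pose h (x : 'I_#|S| * T) : S * T := (enum_val x.1, x.2).
rewrite -(@detf_bij _ _ h).
- by apply: eq_detf => -[i t] [j u]; rewrite /= (inj_eq enum_val_inj).
- by case=> i t [j u] [/enum_val_inj-> ->].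
- by rewrite !card_prod card_ord.
Qed.

End KernelDeterminant.

(** * Characteristic polynomials *)

Lemma poly_eq_cofinite (C : numClosedFieldType) (p q : {poly C}) (s : seq C) :
  (forall a, a \notin s -> p.[a] = q.[a]) -> p = q.
Proof.
move=> pq; apply/eqP; rewrite -subr_eq0.
pose b := (p - q) * \prod_(a <- s) ('X - a%:P).
have b0 : b = 0.
  apply: contraTeq isT => b_neq0.
  pose rs : seq C := [seq i%:R | i <- iota 0 (size b)].
  have uniq_rs : uniq rs.
    by rewrite map_inj_uniq ?iota_uniq // => i j /eqP; rewrite eqr_nat => /eqP.
  have roots_rs : all (root b) rs.
    apply/allP => a _; rewrite /root hornerM.
    have [as_|/pq pqa] := boolP (a \in s); last first.
      by rewrite hornerD hornerN pqa subrr mul0r.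
    by have := root_prod_XsubC s a; rewrite as_ => /rootP->; rewrite mulr0.
  have := max_poly_roots b_neq0 roots_rs uniq_rs.
  by rewrite size_map size_iota ltnn.
move: b0 => /eqP; rewrite mulf_eq0.
by rewrite (negPf (monic_neq0 (monic_prod_XsubC _ _ _))) orbF.
Qed.

Lemma horner_char_poly (C : comNzRingType) n (A : 'M[C]_n) a :
  (char_poly A).[a] = \det (a%:M - A).
Proof.
rewrite -[LHS]/(horner_eval a _) /char_poly -det_map_mx; congr (\det _).
apply/matrixP=> i j; rewrite !mxE /= horner_evalE.
by rewrite hornerD hornerN hornerMn hornerX hornerC.
Qed.

Section Spectrum.
Variable C : numClosedFieldType.

Lemma same_spectrum_char_poly m n (A : 'M[C]_m) (B : 'M[C]_n) :
  same_spectrum A B <-> char_poly A = char_poly B.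
Proof.
split=> [AB|AB a]; last by rewrite !eigenvalue_root_char AB.
have mupE a : mup a (char_poly A) = mup a (char_poly B).
  have [eqE eqM] := AB a; move: eqE eqM; rewrite !eigenvalue_root_char.
  case: (boolP (root (char_poly A) a)) => [_ _|rA /esym/negbT rB _]; first exact.
  by rewrite !mupNroot.
have [rA /esym] := closed_field_poly_normal (char_poly A).
have [rB /esym] := closed_field_poly_normal (char_poly B).
rewrite !(monicP (char_poly_monic _)) !scale1r => EB EA.
rewrite -EA -EB; apply: perm_big; apply/allP => a _ /=; apply/eqP.
by rewrite -!mu_prod_XsubC EA EB mupE.
Qed.

Lemma eq_char_poly_size m n (A : 'M[C]_m) (B : 'M[C]_n) :
  char_poly A = char_poly B -> m = n.
Proof. by move/(congr1 (size \o val)); rewrite /= !size_char_poly => -[]. Qed.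

Lemma char_poly_affine m n (A : 'M[C]_m) (B : 'M[C]_n) c d :
    char_poly A = char_poly B ->
  \det (c%:M + d *: A) = \det (c%:M + d *: B).
Proof.
move=> AB; have mn := eq_char_poly_size AB; subst n.
have [->|d0] := eqVneq d 0; first by rewrite !scale0r !addr0 !det_scalar.
have aff (D : 'M[C]_m) : c%:M + d *: D = (- d) *: ((- (c / d))%:M - D).
  by rewrite scalerBr scale_scalar_mx mulrNN mulrCA divff // mulr1 scaleNr opprK.
by rewrite !aff !detZ -!horner_char_poly AB.
Qed.

(** With J the all-ones matrix, if A J = r J then c I + d A - J factors as
    c I + d A times I - (c + d r)^-1 J, provided that c + d r is nonzero.
    Both determinants are polynomials in c, so they also agree at the exceptional
    value of c. *)
Lemma char_poly_subJ m n (A : 'M[C]_m) (B : 'M[C]_n) r c d :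
    char_poly A = char_poly B ->
    A *m const_mx 1 = r *: (const_mx 1 : 'M_m) ->
    B *m const_mx 1 = r *: (const_mx 1 : 'M_n) ->
  \det (c%:M + d *: A - const_mx 1) = \det (c%:M + d *: B - const_mx 1).
Proof.
move=> AB; have mn := eq_char_poly_size AB; subst n => rA rB.
have : char_poly (const_mx 1 - d *: A) = char_poly (const_mx 1 - d *: B).
  apply: (poly_eq_cofinite (s := [:: - (d * r)])) => a; rewrite inE -addr_eq0.
  move=> adr; rewrite !horner_char_poly !opprB !addrA.
  have fact (D : 'M[C]_m) : D *m const_mx 1 = r *: (const_mx 1 : 'M_m) ->
      a%:M + d *: D - const_mx 1
      = (a%:M + d *: D) *m (1%:M - (a + d * r)^-1 *: const_mx 1).
    move=> rD; rewrite mulmxBr mulmx1 -scalemxAr mulmxDl -scalemxAl rD.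
    by rewrite mul_scalar_mx scalerA -scalerDl scalerA mulVf // scale1r.
  by rewrite !fact // !det_mulmx (char_poly_affine _ _ AB).
by move/(congr1 (horner^~ c)); rewrite !horner_char_poly !opprB !addrA.
Qed.

End Spectrum.

(** * Degrees and incidence *)

(** The edges of a graph, as a finite type. *)
Local Notation edge G := {e : {set vertex G} | e \in edges G}.

Section Incidence.
Variable G : sgraph.

(** The degree of a vertex. *)
Definition deg (x : G) := #|[set y | adj x y]|.

(** Regularity with a prescribed degree. *)
Definition regular_of k := forall x : G, deg x = k.

Lemma edgeP (A : {set G}) :
  reflect (exists u v, adj u v /\ A = [set u; v]) (A \in edges G).
Proof.
apply: (iffP imsetP) => [[[u v]]|[u [v [uv ->]]]].
  by rewrite inE /= => uv ->; exists u, v.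
by exists (u, v); rewrite ?inE.
Qed.

(** The entries of the incidence matrix times its transpose. *)
Lemma card_common_edges r (u v : G) : regular_of r ->
  #|[set e : edge G | (u \in val e) && (v \in val e)]| =
  (adj u v + (u == v) * r)%N.
Proof.
move=> reg.
rewrite -(card_imset _ val_inj).
have -> : val @: [set e : edge G | (u \in val e) && (v \in val e)]
          = [set A in edges G | (u \in A) && (v \in A)].
  apply/setP=> A; rewrite inE; apply/imsetP/andP => [[e]|[AE Auv]].
    by rewrite inE => Auv ->; split=> //; apply: (valP e).
  by exists (exist (fun A => A \in edges G) A AE); rewrite ?inE.
have [<-{v}|uv] := eqVneq u v.
  rewrite adj_irrefl mul1n -(reg u) /deg.
  rewrite -(@card_in_imset _ _ (fun y => [set u; y])).
    apply: eq_card => A; rewrite !inE andbb.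
    apply/andP/imsetP => [[/edgeP[x [y [xy ->]]]]|[y]].
      rewrite !inE => /orP[] /eqP->; first by exists y; rewrite ?inE.
      by exists x; rewrite ?inE 1?adj_sym // setUC.
    rewrite inE => uy ->; rewrite !inE eqxx; split=> //.
    by apply/edgeP; exists u, y.
  move=> y z; rewrite !inE => uy uz /setP/(_ y); rewrite !inE eqxx orbT.
  by move/esym/orP=> [] /eqP // yu; rewrite yu adj_irrefl in uy.
rewrite addn0; have edge_uv A : A \in edges G -> u \in A -> v \in A ->
    adj u v /\ A = [set u; v].
  move=> /edgeP[x [y [xy ->]]]; rewrite !inE.
  move=> /orP[] /eqP ux /orP[] /eqP vy; subst u v; rewrite ?eqxx // in uv *.
  by rewrite adj_sym setUC.
case: (boolP (adj u v)) => [auv|nauv].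
  rewrite -[RHS](cards1 [set u; v]); apply: eq_card => A; rewrite !inE.
  apply/and3P/eqP => [[AE uA vA]|->]; first by have [] := edge_uv A AE uA vA.
  by rewrite !inE !eqxx orbT; split=> //; apply/edgeP; exists u, v.
apply/eqP; rewrite cards_eq0 -subset0; apply/subsetP => A; rewrite !inE.
by move=> /and3P[AE uA vA]; have [] := edge_uv A AE uA vA; rewrite (negPf nauv).
Qed.

Lemma card_edge_ends (e : edge G) : #|val e| = 2%N.
Proof.
case: e => A /= /edgeP[u [v [uv ->]]]; rewrite cards2.
by case: eqVneq uv => // ->; rewrite adj_irrefl.
Qed.

(** The handshake lemma. *)
Lemma card_edges_regular r : regular_of r -> (#|{: edge G}| * 2 = #|G| * r)%N.
Proof.
move=> reg; transitivity (\sum_(e : edge G) \sum_(u : G) (u \in val e))%N.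
  rewrite -sum_nat_const; apply: eq_bigr => e _.
  by rewrite -(card_edge_ends e) -sum1_card big_mkcond.
rewrite exchange_big /= -sum_nat_const; apply: eq_bigr => u _.
have := card_common_edges u u reg; rewrite adj_irrefl eqxx mul1n /= add0n => <-.
by rewrite -sum1dep_card [RHS]big_mkcond; apply: eq_bigr => e _; rewrite andbb.
Qed.

End Incidence.

(** * The spectrum of the corona *)

Section CoronaSpectrum.
Variable C : numClosedFieldType.
Implicit Types G H : sgraph.

Lemma sum_adj G s x : regular_of G s -> \sum_(y : G) (adj x y)%:R = s%:R :> C.
Proof.
move=> reg; rewrite -(reg x) /deg -sum1dep_card natr_sum [RHS]big_mkcond.
by apply: eq_bigr => y _; case: adj.
Qed.

Lemma adjmx_const1 G r : regular_of G r ->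
  adjmx C G *m const_mx 1 = r%:R *: (const_mx 1 : 'M_#|G|).
Proof.
move=> reg; apply/matrixP=> i j; rewrite !mxE mulr1 -(sum_adj (enum_val i) reg).
by rewrite [in RHS]sum_enum_val; apply: eq_bigr => k _; rewrite !mxE mulr1.
Qed.

Lemma horner_char_poly_adjmx G (a : C) :
  (char_poly (adjmx C G)).[a] = detf (fun x y : G => a *+ (x == y) - (adj x y)%:R).
Proof.
rewrite horner_char_poly; congr (\det _); apply/matrixP=> i j.
by rewrite !mxE (inj_eq enum_val_inj).
Qed.

Lemma sum_delta (T : finType) (F : T -> C) x : \sum_y F y *+ (x == y) = F x.
Proof.
rewrite (bigD1 x) //= eqxx mulr1n big1 ?addr0 // => y.
by rewrite eq_sym => /negPf->.
Qed.

(** The copies of H contribute the last factor and the edges of G the power of a;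
    the first factor is the determinant of the Schur complement on G. *)
Lemma char_poly_corona G H r s (a : C) :
    regular_of G r -> regular_of H s -> a != 0 -> a != s%:R ->
  (char_poly (adjmx C (corona G H))).[a] =
    \det ((a + 1 - r%:R / a - #|H|%:R / (a - s%:R))%:M
          + (1 - a^-1) *: adjmx C G - const_mx 1)
    * a ^+ #|{: edge G}|
    * (char_poly (adjmx C H)).[a] ^+ #|G|.
Proof.
move=> regG regH a0 as0; have as0' : a - s%:R != 0 by rewrite subr_eq0.
rewrite horner_char_poly_adjmx.
(* The constant vector is an eigenvector of H, so - (a - s)^-1 times it solves the
   system for each copy. *)
pose X (t : G * H) (b : central G) : C :=
  if b is inl u then - (a - s%:R)^-1 *+ (u == t.1) else 0.
rewrite (detf_schur (X := X)); last first.
  move=> [v x] [u|e] /=; last by rewrite big1 ?subr0 // => *; rewrite mulr0.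
  transitivity (\sum_w \sum_y (a *+ ((v, x) == (w, y)) - ((v == w) && adj x y)%:R)
      * (- (a - s%:R)^-1 *+ (u == w))); last first.
    by rewrite pair_bigA; apply: eq_bigr => -[w y] _.
  under eq_bigr => w _ do rewrite -mulr_suml mulrnAr.
  rewrite sum_delta sub0r.
  have [->|vu] := eqVneq v u; last first.
    rewrite big1 ?mul0r ?oppr0 //.
    by move=> y _; rewrite xpair_eqE (negPf vu) subr0.
  under eq_bigr => y _ do rewrite xpair_eqE eqxx /=.
  by rewrite sumrB sum_delta (sum_adj x regH) mulrN mulfV.
rewrite horner_char_poly_adjmx -detf_copies; congr (_ * _); last first.
  apply: eq_detf => -[v x] [w y] /=.
  rewrite -[inr _ == inr _]/((v, x) == (w, y)) xpair_eqE.
  by case: eqP; rewrite //= subr0.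
(* The matrix left on the central graph after eliminating the copies. *)
pose K (b c : central G) : C :=
  a *+ (b == c) - (adj b c)%:R
  - match b, c with
    | inl u, inl v => (#|H|%:R / (a - s%:R)) *+ (u == v)
    | _, _ => 0
    end.
rewrite (@eq_detf _ _ _ K) => [|b c]; last first.
  rewrite /K; congr (_ - _); first by case: b; case: c.
  case: b => [u|e]; last first.
    by rewrite big1 // => -[w y] _; rewrite subr0 mul0r.
  case: c => [v|f]; last by rewrite big1 // => t _; rewrite mulr0.
  transitivity (\sum_(w : G) \sum_(y : H)
      (((a - s%:R)^-1 *+ (v == w)) *+ (u == w))).
    rewrite pair_bigA; apply: eq_bigr => -[w y] _ /=; rewrite sub0r mulNr mulr_natl.
    by rewrite !mulNrn opprK.
  under eq_bigr => w _ do rewrite sumr_const -mulrnAC.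
  by rewrite sum_delta -mulrnAr mulr_natl eq_sym mulrnAC.
(* The block of the edges is the scalar matrix a, and that below the base is
   minus the transposed incidence matrix. *)
pose X' (e : edge G) (u : G) : C := - a^-1 *+ (u \in val e).
rewrite (detf_schur (X := X')); last first.
  move=> e u; rewrite /K /X' /= subr0 sub0r.
  transitivity (\sum_(f : edge G) (a * (- a^-1 *+ (u \in val f))) *+ (e == f)).
    by rewrite sum_delta mulrnAr mulrN mulfV // mulNrn.
  by apply: eq_bigr => f _; rewrite !subr0 mulrnAl.
congr (_ * _); last first.
  by rewrite -detf_diag; apply: eq_detf => e f; rewrite /K /= !subr0.
congr (\det _); apply/matrixP=> i j; rewrite !mxE -(inj_eq enum_val_inj).
move: (enum_val i) (enum_val j); rewrite /K /= => u v.
have -> : \sum_(e : edge G) (a *+ 0 - (u \in sval e)%:R - 0) * X' e v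
          = a^-1 * (adj u v + (u == v) * r)%:R.
  rewrite -(card_common_edges u v regG) -sum1dep_card natr_sum.
  rewrite [in RHS]big_mkcond mulr_sumr.
  apply: eq_bigr => e _; rewrite mulr0n subr0 sub0r /X'.
  case: (u \in _); case: (v \in _) => /=; rewrite ?mulr0 ?oppr0 ?mul0r //.
  by rewrite mulr1 mulrNN mul1r.
rewrite -[inl u == inl v]/(u == v) natrD natrM.
have [<-|uv] := eqVneq u v; first by rewrite adj_irrefl /=; field; rewrite a0.
by case: adj => /=; field; rewrite a0.
Qed.

Lemma eigenvalue_degree G s : (0 < #|G|)%N -> regular_of G s ->
  eigenvalue (adjmx C G) s%:R.
Proof.
move=> G_gt0 reg; apply/eigenvalueP; exists (const_mx 1).
  apply/rowP=> j; rewrite !mxE mulr1 -(sum_adj (enum_val j) reg).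
  rewrite [in RHS]sum_enum_val.
  by apply: eq_bigr => k _; rewrite !mxE mul1r adj_sym.
by apply/eqP => /rowP/(_ (Ordinal G_gt0)); rewrite !mxE => /eqP; rewrite oner_eq0.
Qed.

(** For an eigenvector v of the adjacency matrix A, the triangle inequality bounds
    the modulus of each entry of v A; the bound follows by summing over entries. *)
Lemma eigenvalue_le_degree G s (a : C) : regular_of G s ->
  eigenvalue (adjmx C G) a -> `|a| <= s%:R.
Proof.
move=> reg /eigenvalueP[v vA v0].
have v_gt0 : 0 < \sum_j `|v 0 j|.
  rewrite lt0r sumr_ge0 ?andbT //; apply: contra v0 => /eqP/psumr_eq0P v_eq0.
  by apply/eqP/rowP => j; rewrite mxE; apply/eqP; rewrite -normr_eq0 v_eq0.
rewrite -(ler_pM2r v_gt0) mulr_sumr.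
apply: (@le_trans _ _ (\sum_j \sum_i `|v 0 i| * adjmx C G i j)).
  apply: ler_sum => j _; rewrite -normrM.
  have -> : a * v 0 j = (v *m adjmx C G) 0 j by rewrite vA mxE.
  rewrite mxE; apply: le_trans (ler_norm_sum _ _ _) _; apply: ler_sum => i _.
  by rewrite normrM mxE normr_nat.
rewrite exchange_big mulr_sumr; apply: ler_sum => i _ /=.
rewrite -mulr_sumr mulrC -(sum_adj (enum_val i) reg) [in leRHS]sum_enum_val.
by under eq_bigr => j _ do rewrite mxE.
Qed.

(** The degree of a regular graph is its largest eigenvalue. *)
Lemma cospectral_degree_eq G1 G2 r1 r2 :
    (0 < #|G1|)%N -> (0 < #|G2|)%N -> regular_of G1 r1 -> regular_of G2 r2 ->
    char_poly (adjmx C G1) = char_poly (adjmx C G2) ->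
  r1 = r2.
Proof.
move=> G1_gt0 G2_gt0 reg1 reg2 eqG; apply/eqP; rewrite eqn_leq -!(ler_nat C).
have e1 := eigenvalue_degree G1_gt0 reg1; have e2 := eigenvalue_degree G2_gt0 reg2.
rewrite -{1}(normr_nat C r1) (eigenvalue_le_degree reg2); last first.
  by rewrite eigenvalue_root_char -eqG -eigenvalue_root_char.
rewrite -(normr_nat C r2) (eigenvalue_le_degree reg1) //.
by rewrite eigenvalue_root_char eqG -eigenvalue_root_char.
Qed.

Lemma cospectral_card_eq G1 G2 :
  char_poly (adjmx C G1) = char_poly (adjmx C G2) -> #|G1| = #|G2|.
Proof. exact: eq_char_poly_size. Qed.

Lemma corona_char_poly_eq G1 G2 H1 H2 r s :
    regular_of G1 r -> regular_of G2 r -> regular_of H1 s -> regular_of H2 s ->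
    char_poly (adjmx C G1) = char_poly (adjmx C G2) ->
    char_poly (adjmx C H1) = char_poly (adjmx C H2) ->
  char_poly (adjmx C (corona G1 H1)) = char_poly (adjmx C (corona G2 H2)).
Proof.
move=> regG1 regG2 regH1 regH2 eqG eqH.
have cG := cospectral_card_eq eqG; have cH := cospectral_card_eq eqH.
have cE : #|{: edge G1}| = #|{: edge G2}|.
  apply/eqP; rewrite -(eqn_pmul2r (ltn0Sn 1)).
  by rewrite (card_edges_regular regG1) (card_edges_regular regG2) cG.
apply: (poly_eq_cofinite (s := [:: 0; s%:R])) => a; rewrite !inE negb_or.
case/andP=> a0 as0.
rewrite (char_poly_corona regG1 regH1) // (char_poly_corona regG2 regH2) //.
rewrite eqH cH cE; congr (_ * _ * _); last by rewrite cG.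
exact: char_poly_subJ eqG (adjmx_const1 regG1) (adjmx_const1 regG2).
Qed.

End CoronaSpectrum.

(** * Isomorphisms between coronas *)

Section CoronaIsomorphism.
Implicit Types G H : sgraph.

Lemma iso_deg G1 G2 (f : G1 -> G2) : bijective f ->
  (forall x y, adj (f x) (f y) = adj x y) -> forall x, deg (f x) = deg x.
Proof.
move=> bij_f fE x; rewrite /deg -(card_imset _ (bij_inj bij_f)).
case: (bij_f) => g fK gK; apply: eq_card => y; rewrite -(gK y) inE fE.
by rewrite mem_imset ?inE //; apply: bij_inj.
Qed.

Lemma deg_lt_card G (x : G) : (deg x < #|G|)%N.
Proof.
rewrite -cardsT; apply: proper_card; apply/properP; split; first exact: subsetT.
by exists x; rewrite !inE // adj_irrefl.
Qed.

Lemma complete_of_deg G (x y : G) : (#|G| <= (deg x).+1)%N -> x != y -> adj x y.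
Proof.
move=> dx xy; apply: contraLR dx => nadj.
have sub : [set z | adj x z] \subset ~: [set x; y].
  apply/subsetP => z; rewrite !inE => xz; apply/norP; split.
    by apply: contraTneq xz => ->; rewrite adj_irrefl.
  by apply: contraTneq xz => ->.
have := cardsC [set x; y]; have := subset_leq_card sub.
rewrite -[#|[set z | _]|]/(deg x) cards2 xy -ltnNge => le <-.
by rewrite add2n !ltnS.
Qed.

Lemma isomorphic_complete G1 G2 : #|G1| = #|G2| ->
    (forall x y : G1, x != y -> adj x y) -> (forall x y : G2, x != y -> adj x y) ->
  isomorphic G1 G2.
Proof.
move=> card_eq c1 c2.
have inj : injective (fun x : G1 => enum_val (cast_ord card_eq (enum_rank x)) : G2).
  by move=> x y /enum_val_inj/cast_ord_inj/enum_rank_inj.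
exists (fun x : G1 => enum_val (cast_ord card_eq (enum_rank x)) : G2).
  by apply: inj_card_bij; rewrite ?card_eq.
move=> x y; have [<-|xy] := eqVneq x y; first by rewrite !adj_irrefl.
by rewrite c1 // c2 // (inj_eq inj).
Qed.

Lemma noniso_deg_bounds G1 G2 r :
    #|G1| = #|G2| -> connected G1 -> regular_of G1 r -> regular_of G2 r ->
    ~ isomorphic G1 G2 ->
  (0 < r)%N /\ (r.+1 < #|G1|)%N.
Proof.
move=> card_eq [_ con] reg1 reg2 niso.
have r_lt : (r.+1 < #|G1|)%N.
  rewrite ltnNge; apply/negP=> G_le; apply: niso; apply: isomorphic_complete => //.
    by move=> x y; apply: complete_of_deg; rewrite reg1.
  by move=> x y; apply: complete_of_deg; rewrite reg2 -card_eq.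
split=> //; have : (1 < #|G1|)%N by apply: leq_ltn_trans r_lt.
case/card_gt1P=> x [y [_ _ xy]]; rewrite -(reg1 x) /deg card_gt0.
have /connectP[[|z p] /=] := con x y; first by move=> _ yx; rewrite yx eqxx in xy.
by case/andP=> xz _ _; apply/set0Pn; exists z; rewrite inE.
Qed.

(** The vertices of [G] inside the corona. *)
Definition base G H (v : G) : corona G H := inl (inl v).
Definition is_base G H (a : corona G H) : bool :=
  if a is inl (inl _) then true else false.

Lemma is_baseP G H (a : corona G H) : reflect (exists v, a = base H v) (is_base a).
Proof.
by apply: (iffP idP) => [|[v ->] //]; case: a => [[v|e]|[v x]] // _; exists v.
Qed.

(** Each vertex of [G] other than [v] contributes a neighbour of [v] in the central
    graph: itself if it is not adjacent to [v], otherwise the vertex that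
    subdivides the edge from [v] to it.  The others lie in the copy of [H]. *)
Lemma deg_base G H (v : G) : (#|G|.-1 + #|H| <= deg (base H v))%N.
Proof.
have edge_in u : adj v u -> [set v; u] \in edges G.
  by move=> vu; apply/edgeP; exists v, u.
pose h (t : G + H) : corona G H :=
  match t with
  | inl u => if insub [set v; u] is Some e then inl (inr e) else inl (inl u)
  | inr x => inr (v, x)
  end.
have cardA : #|[set t : G + H | t != inl v]| = (#|G|.-1 + #|H|)%N.
  have := cardsC1 (inl v : G + H); rewrite card_sum => cE.
  have <- : (#|G| + #|H|).-1 = (#|G|.-1 + #|H|)%N.
    by have : (0 < #|G|)%N by [apply/card_gt0P; exists v]; case: #|G|.
  by rewrite -cE; apply: eq_card => t; rewrite !inE.
rewrite -cardA /deg -(@card_in_imset _ _ h).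
  apply/subset_leq_card/subsetP => _ /imsetP[t tv ->]; rewrite inE in tv.
  rewrite inE; case: t tv => [u|x] /= uv; last by rewrite eqxx.
  case: insubP => [e _ ee|ne] /=; first by rewrite ee !inE eqxx.
  by rewrite eq_sym uv; apply: contra ne => /edge_in.
move=> [u|x] [w|y]; rewrite !inE /=.
- move=> uv wv; case: insubP => [e _ ee|ne]; case: insubP => [f _ ff|nf] // [].
    move=> ef; have := ff; rewrite -ef ee => /setP/(_ u); rewrite !inE eqxx orbT.
    by rewrite -[u == v]/(inl u == inl v :> G + H) (negPf uv) /= => /esym/eqP->.
  by move=> ->.
- by case: insubP.
- by case: insubP.
- by move=> _ _ [->].
Qed.

Lemma deg_edge_vertex G H (e : edge G) : (deg (inl (inr e) : corona G H) <= 2)%N.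
Proof.
rewrite -(card_edge_ends e) /deg -(@card_imset _ _ (@base G H)) => [|u v [] //].
apply/subset_leq_card/subsetP => -[[u|f]|[u x]]; rewrite inE //= => ue.
by apply/imsetP; exists u.
Qed.

Lemma deg_copy_vertex G H v x : (deg (inr (v, x) : corona G H) <= (deg x).+1)%N.
Proof.
pose h (o : option H) : corona G H := if o is Some y then inr (v, y) else base H v.
have inj_h : injective h by case=> [y|] [z|] //= [->].
pose A := None |: Some @: [set y | adj x y].
have <- : #|A| = (deg x).+1.
  rewrite cardsU1 card_imset; last exact: Some_inj.
  by case: imsetP => [[]|].
rewrite -(card_imset A inj_h).
apply/subset_leq_card/subsetP => -[[u|f]|[u y]]; rewrite inE //=.
  by move/eqP=> ->; apply/imsetP; exists None; rewrite ?inE.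
case/andP=> /eqP<- xy; apply/imsetP; exists (Some y) => //.
by rewrite !inE /= mem_imset ?inE //; apply: Some_inj.
Qed.

(** When the degree of the base vertices exceeds those of the edge and copy
    vertices, the base is recognised by degrees. *)
Lemma is_base_deg G H s (a : corona G H) :
    regular_of H s -> (maxn 2 s.+1 < #|G|.-1 + #|H|)%N ->
  is_base a = (maxn 2 s.+1 < deg a)%N.
Proof.
move=> reg big; case: a => [[v|e]|[v x]] /=; apply/esym.
- exact: leq_trans big (deg_base _ _).
- by apply/negbTE; rewrite -leqNgt leq_max deg_edge_vertex.
- apply/negbTE; rewrite -leqNgt leq_max -(reg x); apply/orP; right.
  exact: deg_copy_vertex.
Qed.

Lemma iso_is_base G1 G2 H1 H2 s (f : corona G1 H1 -> corona G2 H2) :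
    #|G1| = #|G2| -> #|H1| = #|H2| -> regular_of H1 s -> regular_of H2 s ->
    (maxn 2 s.+1 < #|G1|.-1 + #|H1|)%N ->
    bijective f -> (forall a b, adj (f a) (f b) = adj a b) ->
  forall a, is_base (f a) = is_base a.
Proof.
move=> cG cH reg1 reg2 big bij_f fE a.
rewrite (is_base_deg _ reg1) // (is_base_deg _ reg2) -?cG -?cH //.
by rewrite (iso_deg bij_f).
Qed.

(** Two base vertices are adjacent in the corona exactly when they are distinct
    and not adjacent in the base graph. *)
Lemma iso_corona_base G1 G2 H1 H2 (f : corona G1 H1 -> corona G2 H2) :
    #|G1| = #|G2| -> bijective f -> (forall a b, adj (f a) (f b) = adj a b) ->
    (forall a, is_base (f a) = is_base a) ->
  isomorphic G1 G2.
Proof.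
move=> cG /bij_inj inj_f fE fbase.
have /fin_all_exists[g gE] (v : G1) : exists w : G2, f (base H1 v) = base H2 w.
  by apply/is_baseP; rewrite fbase.
have inj_g : injective g.
  by move=> u v guv; have := gE u; rewrite guv -gE => /inj_f[].
exists g; first by apply: inj_card_bij; rewrite ?cG.
move=> u v; have := fE (base H1 u) (base H1 v); rewrite !gE /= (inj_eq inj_g).
by have [<-|_ /= /negb_inj //] := eqVneq u v; rewrite !adj_irrefl.
Qed.

Lemma iso_corona_copy G1 G2 H1 H2 (f : corona G1 H1 -> corona G2 H2) :
    (0 < #|G1|)%N -> #|H1| = #|H2| -> (forall x : H1, exists y, adj x y) ->
    bijective f -> (forall a b, adj (f a) (f b) = adj a b) ->
    (forall a, is_base (f a) = is_base a) ->
  isomorphic H1 H2.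
Proof.
case/card_gt0P=> v _ cH nbr /bij_inj inj_f fE fbase.
have [w fv] : exists w, f (base H1 v) = base H2 w by apply/is_baseP; rewrite fbase.
(* The image of (v, x) is not an edge vertex, since the image of a neighbour (v, y)
   of (v, x) lies outside of the base. *)
have /fin_all_exists[g gE] (x : H1) : exists x', f (inr (v, x)) = inr (w, x').
  have [y xy] := nbr x.
  have := fbase (inr (v, x)); have := fbase (inr (v, y)).
  have := fE (base H1 v) (inr (v, x)); have := fE (inr (v, x)) (inr (v, y)).
  rewrite fv /= xy !eqxx /=.
  case: (f (inr (v, x))) => [[u|e]|[u x']] //=.
    by case: (f (inr (v, y))) => [[u|e']|[u y']].
  by move=> _ /eqP<-; exists x'.
have inj_g : injective g.
  by move=> x y gxy; have := gE x; rewrite gxy -gE => /inj_f[].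
exists g; first by apply: inj_card_bij; rewrite ?cH.
by move=> x y; have := fE (inr (v, x)) (inr (v, y)); rewrite !gE /= !eqxx.
Qed.

Lemma noniso_corona_base G1 G2 H1 H2 r s :
    connected G1 -> connected H1 -> #|G1| = #|G2| -> #|H1| = #|H2| ->
    regular_of G1 r -> regular_of G2 r -> regular_of H1 s -> regular_of H2 s ->
  ~ isomorphic G1 G2 -> ~ isomorphic (corona G1 H1) (corona G2 H2).
Proof.
move=> conG1 [/card_gt0P[x _] _] cG cH regG1 regG2 regH1 regH2 niso.
have [r_gt0 r_lt] := noniso_deg_bounds cG conG1 regG1 regG2 niso.
have s_lt : (s < #|H1|)%N by rewrite -(regH1 x) deg_lt_card.
case=> f bij_f fE; apply: niso; apply: (iso_corona_base cG bij_f fE).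
apply: (iso_is_base cG cH regH1 regH2) => //; lia.
Qed.

Lemma noniso_corona_copy G1 G2 H1 H2 s :
    (0 < #|G1|)%N -> #|G1| = #|G2| -> connected H1 -> #|H1| = #|H2| ->
    regular_of H1 s -> regular_of H2 s ->
  ~ isomorphic H1 H2 -> ~ isomorphic (corona G1 H1) (corona G2 H2).
Proof.
move=> G1_gt0 cG conH1 cH regH1 regH2 niso.
have [s_gt0 s_lt] := noniso_deg_bounds cH conH1 regH1 regH2 niso.
case=> f bij_f fE; apply: niso; apply: (iso_corona_copy G1_gt0 cH _ bij_f fE).
  move=> x; have : (0 < deg x)%N by rewrite regH1.
  by case/card_gt0P=> y; rewrite inE => xy; exists y.
apply: (iso_is_base cG cH regH1 regH2) => //; lia.
Qed.

End CoronaIsomorphism.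

Theorem corollary3p5 (C : numClosedFieldType) :
  (forall G1 G2 H : sgraph,
     connected G1 -> connected G2 -> connected H ->
     regular G1 -> regular G2 -> regular H ->
     A_cospectral C G1 G2 ->
     A_cospectral C (corona H G1) (corona H G2))
  /\
  (forall G1 G2 H : sgraph,
     connected G1 -> connected G2 -> connected H ->
     regular G1 -> regular G2 -> regular H ->
     A_cospectral C G1 G2 ->
     A_cospectral C (corona G1 H) (corona G2 H))
  /\
  (forall G1 G2 H1 H2 : sgraph,
     connected G1 -> connected G2 -> connected H1 -> connected H2 ->
     regular G1 -> regular G2 -> regular H1 -> regular H2 ->
     A_cospectral C G1 G2 -> A_cospectral C H1 H2 ->
     A_cospectral C (corona G1 H1) (corona G2 H2)).
Proof.
have deg_eq (G1 G2 : sgraph) k1 k2 : connected G1 -> connected G2 ->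
    regular_of G1 k1 -> regular_of G2 k2 ->
    char_poly (adjmx C G1) = char_poly (adjmx C G2) -> regular_of G2 k1.
  move=> [G1_gt0 _] [G2_gt0 _] reg1 reg2 eqG.
  by rewrite (cospectral_degree_eq G1_gt0 G2_gt0 reg1 reg2 eqG).
split; last split.
- move=> G1 G2 H con1 con2 conH [s reg1] [s' reg2'] [r regH].
  case=> niso /same_spectrum_char_poly eqG.
  have reg2 := deg_eq _ _ _ _ con1 con2 reg1 reg2' eqG.
  split; last first.
    apply/same_spectrum_char_poly.
    exact: (corona_char_poly_eq regH regH reg1 reg2 erefl eqG).
  have [H_gt0 _] := conH.
  exact: (noniso_corona_copy H_gt0 erefl con1 (cospectral_card_eq eqG)
    reg1 reg2 niso).
- move=> G1 G2 H con1 con2 conH [r reg1] [r' reg2'] [s regH].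
  case=> niso /same_spectrum_char_poly eqG.
  have reg2 := deg_eq _ _ _ _ con1 con2 reg1 reg2' eqG.
  split; last first.
    apply/same_spectrum_char_poly.
    exact: (corona_char_poly_eq reg1 reg2 regH regH eqG erefl).
  exact: (noniso_corona_base con1 conH (cospectral_card_eq eqG) erefl
    reg1 reg2 regH regH niso).
move=> G1 G2 H1 H2 conG1 conG2 conH1 conH2 [r regG1] [r' regG2'].
move=> [s regH1] [s' regH2'] [nisoG /same_spectrum_char_poly eqG].
case=> _ /same_spectrum_char_poly eqH.
have regG2 := deg_eq _ _ _ _ conG1 conG2 regG1 regG2' eqG.
have regH2 := deg_eq _ _ _ _ conH1 conH2 regH1 regH2' eqH.
split; last first.
    apply/same_spectrum_char_poly.
    exact: (corona_char_poly_eq regG1 regG2 regH1 regH2 eqG eqH).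
exact: noniso_corona_base conG1 conH1 (cospectral_card_eq eqG)
  (cospectral_card_eq eqH) regG1 regG2 regH1 regH2 nisoG.
Qed.
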